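(* The inequalities $$u_k+y_i\ge 1\quad \forall i\in N,\ \forall d_k\in D_i \text{ with } |\{j\in N\setminus\{i\}: d_{ij}<d_k\}|<\alpha$$ are valid inequalities for the formulation (APC2) of the discrete $\alpha$-neighbor $p$-center problem, i.e., when adding these inequalities to (APC2), the set of feasible solutions does not change.
   Context: Given are a finite set of points $N$, a positive integer $p<|N|$, a positive integer $\alpha\le p$, and distances $d_{ij}\ge 0$ for $i,j\in N$ (an instance of the discrete $\alpha$-neighbor $p$-center problem). Let $D=\{d_{ij}: i,j\in N, i\ne j\}=\{d_1,\dots,d_K\}$ with $d_1<d_2<\dots<d_K$, and for $i\in N$ let $D_i=\{d_{ij}: j\in N\setminus\{i\}\}\setminus\{d_1\}$. Formulation (APC2), in variables $u_k$ ($k=2,\dots,K$) and $y_j$ ($j\in N$): minimize $d_1+\sum_{k=2}^K(d_k-d_{k-1})u_k$ subject to - $\sum_{j\in N}y_j=p$; - $u_{k-1}\ge u_k$ for all $k\in\{3,\dots,K\}$; - $\alpha u_k+\sum_{j\in N\setminus\{i\}: d_{ij}<d_k} y_j\ge \alpha(1-y_i)$ for all $i\in N$ and all $d_k\in D_i$; - $u_k\in\{0,1\}$ for all $k\in\{2,\dots,K\}$; $y_j\in\{0,1\}$ for all $j\in N$. *)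

(* Defs.v *)
From mathcomp Require Import all_boot all_order all_algebra.

Set Implicit Arguments.
Unset Strict Implicit.
Unset Printing Implicit Defensive.

Import Order.TTheory GRing.Theory Num.Theory.
Local Open Scope ring_scope.

(* A minimization problem over the decision vectors of type X. *)
Record program (R X : Type) := Program {
  objective : X -> R;
  feasible : X -> Prop
}.

Definition add_constraints (R X : Type) (P : program R X) (C : X -> Prop) :
    program R X :=
  Program (objective P) (fun x => feasible P x /\ C x).

Definition valid_constraints (R X : Type) (P : program R X) (C : X -> Prop) :=
  forall x, feasible (add_constraints P C) x <-> feasible P x.

Section APC2.

Variables (R : realFieldType) (N : finType) (d : N -> N -> R).

(* The set D = {d_1 < ... < d_K}, as a strictly increasing sequence. *)
Definition dists : seq R :=
  sort <=%R (undup [seq d ij.1 ij.2 | ij in [pred ij : N * N | ij.1 != ij.2]]).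

(* Counted from 0: [dist k] is d_(k+1). *)
Definition dist (k : nat) : R := dists`_k.

(* Index type of the variables u_2, ..., u_K: the ordinal k stands for the
   index k + 2, so the distance attached to [u k] is [dist k.+1], and the one
   before it is [dist k]. *)
Definition uindex := 'I_(size dists).-1.

Definition dists_from (i : N) : seq R :=
  [seq x <- [seq d i j | j in [pred j | j != i]] | x != dist 0].

Definition closer (i : N) (r : R) : {set N} :=
  [set j | (j != i) && (d i j < r)].

Definition apc2_vars := ({ffun uindex -> R} * {ffun N -> R})%type.

Definition apc2_objective (x : apc2_vars) : R :=
  let: (u, _) := x in
  dist 0 + \sum_(k : uindex) (dist k.+1 - dist k) * u k.

Definition apc2_feasible (p alpha : nat) (x : apc2_vars) : Prop :=
  let: (u, y) := x in
  [/\ \sum_j y j = p%:R,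
      forall k l : uindex, l = k.+1 :> nat -> u k >= u l,
      forall (i : N) (k : uindex), dist k.+1 \in dists_from i ->
        alpha%:R * u k + \sum_(j in closer i (dist k.+1)) y j
          >= alpha%:R * (1 - y i),
      forall k : uindex, u k = 0 \/ u k = 1
    & forall j : N, y j = 0 \/ y j = 1].

Definition apc2 (p alpha : nat) : program R apc2_vars :=
  Program apc2_objective (apc2_feasible p alpha).

End APC2.

(* Main.v *)
Require Import Defs.
From mathcomp Require Import all_boot all_order all_algebra.

Import Order.TTheory GRing.Theory Num.Theory.
Local Open Scope ring_scope.

(** The added inequality can fail at a binary point only when [u k = 0] and
    [y i = 0]. The covering constraint of [i] at the distance of [u k] then asks
    for [alpha] open centers strictly closer to [i] than that distance, while
    fewer than [alpha] points lie there. *)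

Lemma sum_le_card (R : numDomainType) (T : finType) (A : {set T}) (y : T -> R) :
  (forall j, j \in A -> y j <= 1) -> \sum_(j in A) y j <= #|A|%:R.
Proof.
move=> y_le1; rewrite -sumr_const.
exact: ler_sum.
Qed.

Theorem theorem7 (R : realFieldType) (N : finType) (p alpha : nat)
    (d : N -> N -> R)
    (p_gt0 : (0 < p)%N) (p_lt_N : (p < #|N|)%N)
    (alpha_gt0 : (0 < alpha)%N) (alpha_le_p : (alpha <= p)%N)
    (d_ge0 : forall i j : N, 0 <= d i j) :
  valid_constraints (apc2 d p alpha)
    (fun x : apc2_vars d =>
       let: (u, y) := x in
       forall (i : N) (k : uindex d),
         dist d k.+1 \in dists_from d i ->
         (#|closer d i (dist d k.+1)| < alpha)%N ->
         u k + y i >= 1).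
Proof.
move=> [u y]; split=> [[] //|feas]; split=> // i k dk few.
have [_ _ cover u01 y01] := feas.
have := cover i k dk.
have [->|->] := u01 k; have [->|->] := y01 i;
  rewrite ?addr0 ?add0r ?lerDl ?ler01 //.
rewrite mulr0 add0r subr0 mulr1 => enough.
have y_le1 j (_ : j \in closer d i (dist d k.+1)) : y j <= 1
  by have [->|->] := y01 j; rewrite ?ler01.
have := le_trans enough (sum_le_card _ _ _ _ y_le1).
by rewrite ler_nat leqNgt few.
Qed.
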